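(* Let $r\ge2$, $d\ge2$ and $n\ge\binom{r+d}{d}$ be integers. The variety $X_{r,d,n}$ is singular along $X_{r,d^2,n}$; that is, every point of $X_{r,d^2,n}\subseteq X_{r,d,n}$ is a singular point of $X_{r,d,n}$.
   Context: The base field $\Bbbk$ is arbitrary; write $b(r,d)=\binom{r+d}{d}$. $\mathbf{M}_{r,d,n}(\mathbf{x})$ is the $b(r,d)\times n$ matrix whose $i$-th column is the vector of all degree $d$ monomials in the homogeneous coordinates of the $i$-th point of $\mathbf{x}\in(\mathbb{P}^r)^n$. For $m\in\{1,2\}$, $X_{r,d^m,n}$ (written $X_{r,d,n}$ for $m=1$) is the closed subscheme of $(\mathbb{P}^r)^n$ defined by the minors of size $b(r,d)-m+1$ of $\mathbf{M}_{r,d,n}(\mathbf{x})$; as a set it consists of the $n$-tuples of points of $\mathbb{P}^r$ that lie on the intersection of $m$ linearly independent degree $d$ hypersurfaces. *)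

(* Defs.v *)
From HB Require Import structures.
From mathcomp Require Import all_boot all_algebra.
From mathcomp Require Import ring.
From mathcomp Require Import boolp.
From mathcomp Require Import mpoly.

Set Implicit Arguments.
Unset Strict Implicit.
Unset Printing Implicit Defensive.

Import GRing.Theory.
Local Open Scope ring_scope.
Local Open Scope quotient_scope.

Section IdealGenerated.
Variables (A : comNzRingType) (G : A -> Prop).

Definition ideal_gen (a : A) : Prop :=
  exists2 s : seq (A * A),
    (forall z, z \in s -> G z.2) & a = \sum_(z <- s) z.1 * z.2.

Lemma ideal_gen0 : ideal_gen 0.
Proof. by exists [::] => //; rewrite big_nil. Qed.

Lemma ideal_genD a b : ideal_gen a -> ideal_gen b -> ideal_gen (a + b).
Proof.
move=> [s sG ->] [t tG ->]; exists (s ++ t); last by rewrite big_cat.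
by move=> z; rewrite mem_cat => /orP[/sG|/tG].
Qed.

Lemma ideal_genM c a : ideal_gen a -> ideal_gen (c * a).
Proof.
move=> [s sG ->]; exists [seq (c * z.1, z.2) | z <- s].
  by move=> _ /mapP[z /sG Gz ->].
by rewrite big_map mulr_sumr; apply: eq_bigr => z _; rewrite mulrA.
Qed.

Lemma ideal_gen_sub (p : idealr A) :
  (forall a, G a -> a \in p) -> forall a, ideal_gen a -> a \in p.
Proof.
move=> Gp a [s sG ->]; rewrite big_seq; apply: rpred_sum => z /sG Gz.
exact/idealMr/Gp.
Qed.

End IdealGenerated.

(* The local ring at a point p (a prime of A) of the closed subscheme of      *)
(* Spec A defined by the ideal I generated by G, for p in that subscheme:     *)
(* (A / I)_(p / I) = A_p / I A_p. Its elements are the fractions a / s with   *)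
(* s \notin p, where a / s = b / t iff u (a t - b s) is in I for some         *)
(* u \notin p. The hypothesis Gp only serves to make this ring nonzero.       *)
Section LocalRing.
Variables (A : comNzRingType) (G : A -> Prop) (p : prime_idealr A).

Definition loc_frac := {x : A * A | x.2 \notin p}.
Implicit Types x y z : loc_frac.

Lemma notin_prime1 : 1 \notin p. Proof. by rewrite idealr1. Qed.

Lemma notin_primeM s t : s \notin p -> t \notin p -> s * t \notin p.
Proof. by move=> sp tp; rewrite prime_idealrM negb_or sp. Qed.

Definition loc_equiv x y : bool :=
  `[< exists2 u, u \notin p &
        ideal_gen G (u * ((val x).1 * (val y).2 - (val y).1 * (val x).2)) >].

Lemma loc_equiv_eq x y :
  (val x).1 * (val y).2 = (val y).1 * (val x).2 -> loc_equiv x y.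
Proof.
move=> e; apply/asboolP; exists 1; first exact: notin_prime1.
by rewrite e subrr mulr0; exact: ideal_gen0.
Qed.

Lemma loc_equiv_refl : reflexive loc_equiv.
Proof. by move=> x; exact: loc_equiv_eq. Qed.

Lemma loc_equiv_sym : ssrbool.symmetric loc_equiv.
Proof.
suff h x y : loc_equiv x y -> loc_equiv y x by move=> x y; apply/idP/idP; exact: h.
move=> /asboolP[u up uI]; apply/asboolP; exists u => //.
suff -> : u * ((val y).1 * (val x).2 - (val x).1 * (val y).2) =
  -1 * (u * ((val x).1 * (val y).2 - (val y).1 * (val x).2))
  by exact: ideal_genM.
by ring.
Qed.

Lemma loc_equiv_trans : transitive loc_equiv.
Proof.
move=> y x z /asboolP[u up uI] /asboolP[v vp vI]; apply/asboolP.
exists (u * v * (val y).2); first by rewrite !notin_primeM // (valP y).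
have := ideal_genD (ideal_genM (v * (val z).2) uI)
                   (ideal_genM (u * (val x).2) vI).
by congr ideal_gen; ring.
Qed.

Canonical loc_equiv_equiv :=
  EquivRel loc_equiv loc_equiv_refl loc_equiv_sym loc_equiv_trans.

Hypothesis Gp : forall a, G a -> a \in p.

Definition local_ring of (forall a, G a -> a \in p) : Type :=
  {eq_quot loc_equiv}.
Local Notation L := (local_ring Gp).

HB.instance Definition _ := EqQuotient.copy L {eq_quot loc_equiv}.
HB.instance Definition _ := Choice.copy L {eq_quot loc_equiv}.

Definition loc_of (a : A) : loc_frac := exist _ (a, 1) notin_prime1.

Definition loc_addf x y : loc_frac :=
  exist _ ((val x).1 * (val y).2 + (val y).1 * (val x).2,
           (val x).2 * (val y).2)
        (notin_primeM (valP x) (valP y)).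
Definition loc_oppf x : loc_frac := exist _ (- (val x).1, (val x).2) (valP x).
Definition loc_mulf x y : loc_frac :=
  exist _ ((val x).1 * (val y).1, (val x).2 * (val y).2)
        (notin_primeM (valP x) (valP y)).

Definition loc_zero : L := \pi_L (loc_of 0).
Definition loc_one : L := \pi_L (loc_of 1).
Definition loc_add (a b : L) : L := \pi_L (loc_addf (repr a) (repr b)).
Definition loc_opp (a : L) : L := \pi_L (loc_oppf (repr a)).
Definition loc_mul (a b : L) : L := \pi_L (loc_mulf (repr a) (repr b)).

Lemma loc_eqP x y : reflect (\pi_L x = \pi_L y) (loc_equiv x y).
Proof. exact: (@eqquotP _ loc_equiv L x y). Qed.

Lemma loc_reprK x : loc_equiv (repr (\pi_L x)) x.
Proof. by apply/loc_eqP; rewrite reprK. Qed.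

Lemma pi_loc_add x y : loc_add (\pi_L x) (\pi_L y) = \pi_L (loc_addf x y).
Proof.
have /asboolP[u up uI] := loc_reprK x; have /asboolP[v vp vI] := loc_reprK y.
apply/loc_eqP/asboolP; exists (u * v); first exact: notin_primeM.
set x' := repr (\pi_L x) in uI *; set y' := repr (\pi_L y) in vI *.
have := ideal_genD (ideal_genM (v * (val y).2 * (val y').2) uI)
                   (ideal_genM (u * (val x).2 * (val x').2) vI).
by congr ideal_gen; rewrite /=; ring.
Qed.

Lemma pi_loc_opp x : loc_opp (\pi_L x) = \pi_L (loc_oppf x).
Proof.
have /asboolP[u up uI] := loc_reprK x.
apply/loc_eqP/asboolP; exists u => //.
by have := ideal_genM (-1) uI; congr ideal_gen; rewrite /=; ring.
Qed.

Lemma pi_loc_mul x y : loc_mul (\pi_L x) (\pi_L y) = \pi_L (loc_mulf x y).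
Proof.
have /asboolP[u up uI] := loc_reprK x; have /asboolP[v vp vI] := loc_reprK y.
apply/loc_eqP/asboolP; exists (u * v); first exact: notin_primeM.
set x' := repr (\pi_L x) in uI *; set y' := repr (\pi_L y) in vI *.
have := ideal_genD (ideal_genM (v * (val y').1 * (val y).2) uI)
                   (ideal_genM (u * (val x).1 * (val x').2) vI).
by congr ideal_gen; rewrite /=; ring.
Qed.

Let locW (P : L -> Prop) : (forall x, P (\pi_L x)) -> forall a, P a.
Proof. by move=> Px a; rewrite -[a]reprK; exact: Px. Qed.

Let locE := (pi_loc_add, pi_loc_opp, pi_loc_mul).

Lemma loc_addA : associative loc_add.
Proof.
elim/locW=> x; elim/locW=> y; elim/locW=> z; rewrite !locE.
by apply/loc_eqP/loc_equiv_eq; rewrite /=; ring.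
Qed.

Lemma loc_addC : commutative loc_add.
Proof.
elim/locW=> x; elim/locW=> y; rewrite !locE.
by apply/loc_eqP/loc_equiv_eq; rewrite /=; ring.
Qed.

Lemma loc_add0 : left_id loc_zero loc_add.
Proof.
elim/locW=> x; rewrite !locE.
by apply/loc_eqP/loc_equiv_eq; rewrite /=; ring.
Qed.

Lemma loc_addN : left_inverse loc_zero loc_opp loc_add.
Proof.
elim/locW=> x; rewrite !locE.
by apply/loc_eqP/loc_equiv_eq; rewrite /=; ring.
Qed.

HB.instance Definition _ :=
  GRing.isZmodule.Build L loc_addA loc_addC loc_add0 loc_addN.

Lemma loc_mulA : associative loc_mul.
Proof.
elim/locW=> x; elim/locW=> y; elim/locW=> z; rewrite !locE.
by apply/loc_eqP/loc_equiv_eq; rewrite /=; ring.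
Qed.

Lemma loc_mulC : commutative loc_mul.
Proof.
elim/locW=> x; elim/locW=> y; rewrite !locE.
by apply/loc_eqP/loc_equiv_eq; rewrite /=; ring.
Qed.

Lemma loc_mul1 : left_id loc_one loc_mul.
Proof.
elim/locW=> x; rewrite !locE.
by apply/loc_eqP/loc_equiv_eq; rewrite /=; ring.
Qed.

Lemma loc_mulDl : left_distributive loc_mul loc_add.
Proof.
elim/locW=> x; elim/locW=> y; elim/locW=> z; rewrite !locE.
by apply/loc_eqP/loc_equiv_eq; rewrite /=; ring.
Qed.

Lemma loc_one_neq0 : loc_one != loc_zero.
Proof.
apply/eqP => /loc_eqP/asboolP[u up /(ideal_gen_sub Gp)].
by rewrite /= !mulr1 subr0 mulr1 (negPf up).
Qed.

HB.instance Definition _ :=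
  GRing.Zmodule_isComNzRing.Build L
    loc_mulA loc_mulC loc_mul1 loc_mulDl loc_one_neq0.

End LocalRing.

Section Regular.
Variable R : comNzRingType.

Definition prime_chain (l : nat) : Prop :=
  exists P : 'I_l.+1 -> prime_idealr R, forall i j : 'I_l.+1, (i < j)%N ->
    {subset P i <= P j} /\ ~ {subset P j <= P i}.

Definition krull_dim (e : nat) : Prop :=
  prime_chain e /\ forall l, prime_chain l -> (l <= e)%N.

(* The maximal ideal m when R is local. *)
Definition nonunit (a : R) : Prop := forall b, a * b <> 1.

(* The ideal m^2. *)
Definition nonunit2 : R -> Prop :=
  ideal_gen (fun c => exists a b, [/\ nonunit a, nonunit b & c = a * b]).

(* R local: the R/m-vector space m/m^2 has dimension e, i.e. some t_i in m    *)
(* (i < e) represent a basis of it.                                           *)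
Definition cotangent_dim (e : nat) : Prop :=
  exists t : 'I_e -> R,
    [/\ forall i, nonunit (t i),
        forall a, nonunit a ->
          exists c : 'I_e -> R, nonunit2 (a - \sum_i c i * t i)
      & forall c : 'I_e -> R,
          nonunit2 (\sum_i c i * t i) -> forall i, nonunit (c i)].

(* Meant for noetherian local rings only. *)
Definition regular : Prop := exists2 e, krull_dim e & cotangent_dim e.

End Regular.

Section Minors.
Variables (A : comNzRingType) (b n : nat) (M : 'M[A]_(b, n)).

Definition is_minor (s : nat) (a : A) : Prop :=
  exists (f : 'I_s -> 'I_b) (g : 'I_s -> 'I_n),
    [/\ {homo f : i j / (i < j)%N}, {homo g : i j / (i < j)%N}
      & a = \det (mxsub f g M)].

End Minors.

Section VeroneseMatrix.

Definition monomials (r d : nat) : seq 'X_{1..r.+1} :=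
  [seq s2m t | t : d.-tuple 'I_r.+1 <- enum (basis r.+1 d)].

Lemma mem_monomials r d m : (m \in monomials r d) = (mdeg m == d).
Proof. by rewrite /monomials -basis_cover. Qed.

Lemma uniq_monomials r d : uniq (monomials r d).
Proof. exact: uniq_basis. Qed.

Lemma size_monomials r d : size (monomials r d) = 'C(r + d, d).
Proof. by rewrite /monomials size_basis addnC. Qed.

(* The matrix M_{r,d,n}(x); the rows of x are homogeneous coordinates of the  *)
(* n points.                                                                  *)
Definition monomial_mx (A : comNzRingType) (r d n : nat)
    (x : 'M[A]_(n, r.+1)) : 'M[A]_('C(r + d, d), n) :=
  \matrix_(a, i) \prod_(l < r.+1) x i l ^+ (nth 0%MM (monomials r d) a l).

End VeroneseMatrix.

Section PointConfigurations.
Variables (k : fieldType) (r n : nat).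

(* The coordinate ring of a standard affine chart of (P^r)^n. *)
Definition chart_ring : comNzRingType := {mpoly k[(n * r)]}.

(* The chart indexed by c : 'I_n -> 'I_r.+1 is the locus where, for all i,    *)
(* the c(i)-th homogeneous coordinate of the i-th point is invertible; it is  *)
(* normalised to 1, the r others being independent variables.                 *)
Definition chart_coords (c : {ffun 'I_n -> 'I_r.+1}) :
    'M[chart_ring]_(n, r.+1) :=
  \matrix_(i, l)
    (if unlift (c i) l is Some l' then 'X_(mxvec_index i l') else 1).

(* Points of the scheme (P^r)^n: a chart together with a prime ideal of its   *)
(* coordinate ring. Every scheme point (closed or not) is obtained, once for  *)
(* each chart it belongs to.                                                  *)
Record point := Point {
  chart : {ffun 'I_n -> 'I_r.+1};
  point_ideal : prime_idealr chart_ring }.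

(* Generators, on the chart c, of the ideal sheaf of X_{r,d^m,n}. *)
Definition X_gens (d m : nat) (c : {ffun 'I_n -> 'I_r.+1}) :
    chart_ring -> Prop :=
  is_minor (monomial_mx d (chart_coords c)) ('C(r + d, d) - m + 1).

Definition in_X (d m : nat) (x : point) : Prop :=
  forall a, X_gens d m (chart x) a -> a \in point_ideal x.

Definition singular_point (d m : nat) (x : point) : Prop :=
  exists hx : in_X d m x, ~ regular (local_ring hx).

End PointConfigurations.

(* Main.v *)
Require Import Defs.
From mathcomp Require Import all_boot all_order all_algebra.
From mathcomp Require Import perm ring zify boolp.
From mathcomp Require Import mpoly.

Set Implicit Arguments.
Unset Strict Implicit.
Unset Printing Implicit Defensive.

Import Order.TTheory GRing.Theory.
Local Open Scope ring_scope.

(** Let A be the coordinate ring of the chart, p the prime of the point, I the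
    ideal of maximal minors and b the number of monomials. Three facts
    contradict each other when the local ring (A/I)_p is regular, of dimension
    e say.

    First, I is contained in p^2 after localisation at p. Modulo p the matrix
    has rank at most b - 2, so eliminating pivots outside p leaves at least
    two rows whose entries lie in p (det_in_square). Hence (A/I)_p and A_p have
    the same cotangent space, and p A_p is generated modulo its square by e
    elements (pullback_gens).

    Secondly, I is not zero: the columns of the first maximal minor are the
    values of the b distinct monomials at independent generic points, so the
    terms of its Leibniz expansion are distinct monomials
    (generic_minor_neq0). The zero ideal therefore lies strictly below every
    prime containing I, and prepending it to a chain of e + 1 primes of
    (A/I)_p gives a chain of e + 2 primes of A inside p.

    Thirdly, a strict chain P_0 < ... < P_l of primes inside p satisfies
    l <= e as soon as p A_p is generated modulo its square by e elements: this
    is the height theorem, for polynomial rings (prime_chain_bound). It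
    is proved by counting monomials. Let N be the number of variables and
    h(D) the dimension of the polynomials of degree < D modulo p, which is
    also the number of standard monomials of degree < D, those that are not
    leading monomials of elements of p.

    - Upper bound for h. By division and Nakayama, there is u outside p such
      that u f is, for every f, the sum of u times a standard polynomial and
      of a combination of the e generators t_i, with linear control on
      degrees. Iterating s times writes u^s f as a combination of the
      u^(s - |m|) t^m g with |m| < s and g standard of degree O(s), up to an
      error vanishing to order s along p. A nonzero f of degree less than s cannot have u^s f vanishing
      to order s (vanish_bound), so with s = O(S) the S^N monomials with
      exponents below S give S^N <= O(S^e) h(O(S)) (box_le_standard).

    - Lower bound. If x_j lies in P_(j+1) but not in P_j, the
      products of standard monomials by powers of the x_j are linearly
      independent (free_chain). With exponents below S, this gives
      h(O(S)) S^l <= O(S^N).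

    Together S^(N+l) <= O(S^(N+e)), so l <= e. Applied to the chain above,
    this reads e + 1 <= e. *)

(** * Standard monomials and division by a prime ideal *)

Lemma exists_relation (k : fieldType) (I J : finType) (a : I -> J -> k) :
  (#|J| < #|I|)%N ->
  exists2 c : I -> k, (exists i, c i != 0)
    & forall j, \sum_i c i * a i j = 0.
Proof.
move=> ltJI.
pose M := \matrix_(i < #|I|, j < #|J|)
  a (enum_val i) (enum_val j).
have /rowV0Pn[v /sub_kermxP vM v_neq0] : kermx M != 0.
  rewrite -mxrank_eq0 mxrank_ker subn_eq0 -ltnNge.
  exact: leq_ltn_trans (rank_leq_col M) ltJI.
exists (fun i => v 0 (enum_rank i)).
  by have /rV0Pn[i vi] := v_neq0; exists (enum_val i); rewrite enum_valK.
move=> j; move/matrixP/(_ 0 (enum_rank j)): vM; rewrite !mxE => vM0.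
rewrite -[RHS]vM0.
rewrite (reindex (fun i' : 'I_#|I| => enum_val i')) /=; last first.
  by apply: onW_bij; exact: enum_val_bij.
by apply: eq_bigr => i _; rewrite mxE enum_valK enum_rankK.
Qed.

(** Dickson's lemma, for the preorder comparing the weights w 0, ..., w (n-1).
    In the inductive step, a generating set for the first n weights works for
    every v whose last weight is at least the maximum K over that set;
    the slices w n v = i with i < K are handled one by one. *)
Lemma dickson (T : eqType) (n : nat) (w : nat -> T -> nat) (Q : T -> Prop) :
  exists s : seq T, (forall b, b \in s -> Q b) /\
    forall v, Q v -> exists2 b, b \in s
        & forall i, (i < n)%N -> (w i b <= w i v)%N.
Proof.
elim: n Q => [|n IH] Q.
  have [[v0 Qv0]|noQ] := pselect (exists v, Q v).
    exists [:: v0]; split=> [b|v _]; first by rewrite inE => /eqP->.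
    by exists v0; rewrite ?mem_head.
  by exists [::]; split=> // v Qv; case: noQ; exists v.
have [s [sQ sP]] := IH Q.
pose K := (\max_(b <- s) w n b)%N.
have [t tP] := choice (fun i => IH (fun v => Q v /\ w n v = i)).
exists (s ++ flatten [seq t i | i <- iota 0 K]); split=> [b|v Qv].
  rewrite mem_cat => /orP[/sQ//|/flattenP[_ /mapP[i _ ->] bt]].
  by have [/(_ _ bt)[]] := tP i.
have [leKv|ltvK] := leqP K (w n v).
  have [b bs bv] := sP v Qv; exists b; first by rewrite mem_cat bs.
  move=> i; rewrite ltnS leq_eqVlt => /predU1P[->|/bv//].
  by apply: leq_trans leKv; exact: leq_bigmax_seq.
have [tQ /(_ v (conj Qv erefl))[b bt bv]] := tP (w n v).
exists b => [|i].
  rewrite mem_cat; apply/orP; right; apply/flattenP; exists (t (w n v)) => //.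
  by apply: map_f; rewrite mem_iota.
rewrite ltnS leq_eqVlt => /predU1P[->|/bv//].
by have [_ ->] := tQ _ bt.
Qed.

Section Division.
Variables (k : fieldType) (N : nat).
Local Notation A := {mpoly k[N]}.

Lemma msize_lead_le (f g : A) : g != 0 -> (mlead g <= mlead f)%O ->
  f != 0 -> (msize g <= msize f)%N.
Proof. by move=> g0 le f0; rewrite -!mlead_deg // ltnS; exact: lemc_mdeg. Qed.

Lemma cancel_lead (f h : A) :
  mlead h = mlead f -> h@_(mlead f) = f@_(mlead f) ->
  f - h != 0 -> (mlead (f - h) < mlead f)%O.
Proof.
move=> hf cf g0; rewrite lt_neqAle; apply/andP; split; last first.
  by apply: le_trans (mleadB_le _ _) _; rewrite hf joinxx.
apply/eqP=> e; move: g0; rewrite -mleadc_eq0 e mcoeffB cf subrr eqxx.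
by [].
Qed.

Lemma mleadZX (c : k) (m : 'X_{1..N}) : c != 0 -> mlead (c *: 'X_[m]) = m.
Proof.
by move=> c0; rewrite mleadZ_proper mleadXm // mcoeffX eqxx mulr1.
Qed.

Lemma mleadcZX (c : k) (m : 'X_{1..N}) : (c *: 'X_[m])@_m = c.
Proof. by rewrite mcoeffZ mcoeffX eqxx mulr1. Qed.

Variable p : prime_idealr A.

Definition standard (m : 'X_{1..N}) : Prop :=
  forall f, f \in p -> f != 0 -> mlead f != m.

Definition standard_poly (l : A) : Prop :=
  forall m, m \in msupp l -> standard m.

Definition standard_monomial (D : nat) : finType :=
  {m : 'X_{1..N < D} | `[< standard m >]}.

Lemma standard_poly0 : standard_poly 0.
Proof. by move=> m; rewrite msupp0. Qed.

Lemma standard_polyD l l' :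
  standard_poly l -> standard_poly l' -> standard_poly (l + l').
Proof. by move=> h h' m /msuppD_le; rewrite mem_cat => /orP[/h|/h']. Qed.

Lemma standard_polyZ c l : standard_poly l -> standard_poly (c *: l).
Proof. by move=> h m /msuppZ_le/h. Qed.

(** Standard polynomials form a complement of p: the leading monomial of a
    nonzero element of p is not standard. *)
Lemma standard_poly_eq0 l : standard_poly l -> l \in p -> l = 0.
Proof.
move=> ls lp; apply/eqP; apply: contraT => l0.
by have := ls _ (mlead_supp l0) l lp l0; rewrite eqxx.
Qed.

(** Division by a Groebner basis of p. Dickson's lemma, applied to the leading
    monomials of the elements of p, provides the finite family F, and leading
    terms are cancelled one at a time. As the monomial order refines the total
    degree, no degree ever exceeds that of f; the counting argument depends on
    this. *)
Lemma division : exists q (F : 'I_q -> A), (forall j, F j \in p) /\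
  forall f, exists l (b : 'I_q -> A),
    [/\ f = l + \sum_j b j * F j, standard_poly l, (msize l <= msize f)%N
      & forall j, (msize (b j) <= msize f)%N].
Proof.
have [s [sp sP]] := dickson N (fun i (f : A) => nth 0%N (mlead f) i)
  (fun f => f \in p /\ f != 0).
exists (size s), (fun j => s`_j).
split=> [j|]; first by have [] := sp _ (mem_nth 0 (ltn_ord j)).
elim/mleadrect=> f IH.
have [->|f0] := eqVneq f 0.
  exists 0, (fun=> 0); split=> //; first 1 last.
  - exact: standard_poly0.
  by rewrite add0r big1 // => j _; rewrite mul0r.
set m := mlead f.
have step h : mlead h = m -> h@_m = f@_m -> (exists l (b : 'I_(size s) -> A),
    [/\ h = l + \sum_j b j * s`_j, standard_poly l, (msize l <= msize f)%N
      & forall j, (msize (b j) <= msize f)%N]) ->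
  exists l (b : 'I_(size s) -> A),
    [/\ f = l + \sum_j b j * s`_j, standard_poly l, (msize l <= msize f)%N
      & forall j, (msize (b j) <= msize f)%N].
  move=> hm hc [l [b [hE ls lf bf]]].
  have [e|g0] := eqVneq (f - h) 0.
    exists l, b; split=> //; rewrite -hE.
    by apply/eqP; rewrite -subr_eq0 e.
  have lt := cancel_lead hm hc g0.
  have [l' [b' [gE ls' lf' bf']]] := IH _ lt.
  have le := msize_lead_le g0 (ltW lt) f0.
  exists (l + l'), (fun j => b j + b' j); split.
  - rewrite -[LHS](subrK h) gE hE addrC addrACA -big_split.
    by congr (_ + _); apply: eq_bigr => j _; rewrite mulrDl.
  - exact: standard_polyD.
  - by apply: leq_trans (msizeD_le _ _) _; rewrite geq_max lf (leq_trans lf').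
  - move=> j; apply: leq_trans (msizeD_le _ _) _.
    by rewrite geq_max bf (leq_trans (bf' j)).
have c0 : f@_m != 0 by rewrite mleadc_eq0.
have [stdm|/existsNP[h0 /not_implyP[h0p /not_implyP[h00 /negP]]]] :=
  pselect (standard m).
  apply: (step (f@_m *: 'X_[m])).
  - exact: mleadZX.
  - exact: mleadcZX.
  exists (f@_m *: 'X_[m]), (fun=> 0); split=> //; first 1 last.
  - by move=> m'; rewrite msuppMCX // inE => /eqP->.
  - rewrite (leq_trans (msizeZ_le _ _)) // msizeX -mlead_deg //.
  - by move=> j; rewrite msize0.
  by rewrite big1 ?addr0 // => j _; rewrite mul0r.
rewrite negbK => /eqP h0m.
have [b bs bP] := sP _ (conj h0p h00).
have [bp b0] := sp _ bs.
have bm : (mlead b <= m)%MM.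
  by apply/mnm_lepP=> i; rewrite !(mnm_nth 0%N) -h0m; exact: bP.
(* The multiple h of b has the same leading term as f. *)
pose a := f@_m / b@_(mlead b).
have a0 : a != 0 by rewrite mulf_neq0 ?invr_eq0 ?mleadc_eq0.
pose h := (a *: 'X_[m - mlead b]) * b.
have lm : mlead (a *: 'X_[m - mlead b]) = (m - mlead b)%MM by exact: mleadZX.
have lc : mleadc (a *: 'X_[m - mlead b]) = a by rewrite lm mleadcZX.
have hm : mlead h = m.
  rewrite mleadM_proper; first by rewrite lm submK.
  by rewrite lc mulf_neq0 // mleadc_eq0.
apply: (step h) => //.
  rewrite -[X in h@_X](submK bm) -lm mleadcM lc /a divfK //.
  by rewrite mleadc_eq0.
have jlt : (index b s < size s)%N by rewrite index_mem.
exists 0, (fun j => if j == Ordinal jlt then a *: 'X_[m - mlead b] else 0).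
split.
- rewrite add0r (bigD1 (Ordinal jlt)) //= eqxx nth_index // big1 ?addr0 //.
  by move=> j /negPf->; rewrite mul0r.
- exact: standard_poly0.
- by rewrite msize0.
move=> j; case: eqP => _; last by rewrite msize0.
rewrite (leq_trans (msizeZ_le _ _)) // msizeX -mlead_deg // ltnS.
exact: mdegB.
Qed.

End Division.

(** * Order of vanishing along a prime ideal *)

Section Vanishing.
Variables (k : fieldType) (N : nat).
Local Notation A := {mpoly k[N]}.

(** The substitution X_i |-> X_i + Y_i, where the Y_i are the variables of the
    outer polynomial ring. The coefficients of taylor f are the Hasse
    derivatives of f, which detect orders of vanishing in every
    characteristic. *)
Definition taylor : A -> {mpoly A[N]} :=
  mmap (@mpolyC N A \o @mpolyC N k) (fun i => 'X_i + ('X_i)%:MP).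

Lemma taylorD f g : taylor (f + g) = taylor f + taylor g.
Proof. exact: rmorphD. Qed.

Lemma taylorM f g : taylor (f * g) = taylor f * taylor g.
Proof. exact: rmorphM. Qed.

Lemma taylor0 : taylor 0 = 0. Proof. exact: rmorph0. Qed.

Lemma taylorE f : taylor f =
  \sum_(m <- msupp f)
    ((f@_m)%:MP)%:MP * \prod_(i < N) ('X_i + ('X_i)%:MP) ^+ m i.
Proof. by []. Qed.

#[local] Opaque taylor.

Lemma mcoeff0_taylor f : (taylor f)@_0 = f.
Proof.
rewrite taylorE [RHS]mpolyE raddf_sum; apply: eq_bigr => m _ /=.
rewrite rmorphM rmorph_prod /= mcoeffC eqxx mulr1 mul_mpolyC.
congr (_ *: _); rewrite mpolyXE_id; apply: eq_bigr => i _.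
by rewrite rmorphXn /= mcoeffD mcoeffX mnm1_eq0 mcoeffC eqxx mulr1 add0r.
Qed.

Lemma mlead_taylorX (m : 'X_{1..N}) :
  let P := \prod_(i < N) ('X_i + ('X_i)%:MP) ^+ m i : {mpoly A[N]} in
  mlead P = m /\ P@_m = 1.
Proof.
have XE i : mlead ('X_i + ('X_i)%:MP : {mpoly A[N]}) = U_(i)%MM.
  by rewrite mleadDl mleadXm // mleadC lt_mdeg_ltmc // mdeg0 mdeg1.
have cE i : mleadc ('X_i + ('X_i)%:MP : {mpoly A[N]}) = 1.
  by rewrite XE mcoeffD mcoeffX eqxx mcoeffC mnm1_eq0 mulr0 addr0.
have lregi i : GRing.lreg (mleadc ('X_i + ('X_i)%:MP : {mpoly A[N]})).
  by rewrite cE; exact: GRing.lreg1.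
have powE i : mlead (('X_i + ('X_i)%:MP : {mpoly A[N]}) ^+ m i)
  = (U_(i) *+ m i)%MM by rewrite mleadX_proper // XE.
have powc i : mleadc (('X_i + ('X_i)%:MP : {mpoly A[N]}) ^+ m i) = 1.
  have := mleadcX ('X_i + ('X_i)%:MP : {mpoly A[N]}) (m i).
  by rewrite cE expr1n powE XE.
move=> P.
have PE : mlead P = m.
  rewrite /P mlead_prod_proper => [|i _ _]; last first.
    by rewrite powc; exact: GRing.lreg1.
  by rewrite [RHS]multinomUE_id; apply: eq_bigr => i _; exact: powE.
split=> //.
rewrite -[X in _@_X]PE /P mlead_prod_proper => [|i _ _]; last first.
  by rewrite powc; exact: GRing.lreg1.
by rewrite mleadc_prod big1 // => i _; exact: powc.
Qed.

(** Substituting X + Y in a monomial gives a polynomial in Y with the same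
    leading monomial and coefficient 1, so the leading terms of distinct
    monomials do not interfere. *)
Lemma mcoeff_taylor_lead f : (taylor f)@_(mlead f) = (f@_(mlead f))%:MP.
Proof.
have [->|f0] := eqVneq f 0; first by rewrite taylor0 !mcoeff0 mpolyC0.
rewrite taylorE raddf_sum /=.
rewrite (bigD1_seq (mlead f)) ?msupp_uniq ?mlead_supp //=.
rewrite mcoeffCM (mlead_taylorX _).2 mulr1.
rewrite big_seq_cond big1 ?addr0 // => m /andP[mf ml].
rewrite mcoeffCM; have [lE _] := mlead_taylorX m.
rewrite [X in _ * X]mcoeff_gt_mlead ?mulr0 // lE.
by rewrite lt_neqAle ml msupp_le_mlead.
Qed.

Variable p : prime_idealr A.

(** Vanishing to order s at the generic point of the zero set of p. *)
Definition vanish (s : nat) (f : A) : Prop :=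
  forall m, (mdeg m < s)%N -> (taylor f)@_m \in p.

Lemma vanishx0 s : vanish s 0.
Proof. by move=> m _; rewrite taylor0 mcoeff0 rpred0. Qed.

Lemma vanishD s f g : vanish s f -> vanish s g -> vanish s (f + g).
Proof.
move=> hf hg m ms; rewrite taylorD mcoeffD.
by apply: rpredD; [apply: hf|apply: hg].
Qed.

Lemma vanishM i j f g : vanish i f -> vanish j g -> vanish (i + j) (f * g).
Proof.
move=> hf hg m ms; rewrite taylorM mcoeffM.
apply: rpred_sum => -[a b] /= /eqP mE.
have mab : mdeg m = (mdeg a + mdeg b)%N by rewrite [in LHS]mE mdegD.
have [ai|] := ltnP (mdeg a) i.
  by rewrite mulrC; apply: idealMr; exact: hf.
by move=> ia; apply: idealMr; apply: hg; lia.
Qed.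

Lemma vanishMl s f g : vanish s g -> vanish s (f * g).
Proof. exact: (@vanishM 0). Qed.

Lemma vanish1 f : f \in p -> vanish 1 f.
Proof.
move=> fp m; rewrite ltnS leqn0 mdeg_eq0 => /eqP->.
by rewrite mcoeff0_taylor.
Qed.

Lemma constant_notin_prime (c : k) : c != 0 -> c%:MP \notin p.
Proof.
move=> c0; apply/negP=> /(idealMr (c^-1)%:MP).
by rewrite -rmorphM mulVf // rmorph1 idealr1.
Qed.

(** The derivative of f of index mlead f is a nonzero constant, so some
    derivative of f of order at most mdeg (mlead f) is outside p. At the lowest
    such order, Leibniz' formula shows that multiplication by u, which is
    outside p, does not change this. *)
Lemma vanish_bound s u f :
  u \notin p -> f != 0 -> vanish s (u * f) -> (s <= mdeg (mlead f))%N.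
Proof.
move=> up f0 uf; rewrite leqNgt; apply/negP=> lt.
pose Q d := `[< exists2 m, mdeg m = d & (taylor f)@_m \notin p >].
have Qlead : Q (mdeg (mlead f)).
  apply/asboolP; exists (mlead f); first by [].
  by rewrite mcoeff_taylor_lead constant_notin_prime ?mleadc_eq0.
have exQ : exists d, Q d by exists (mdeg (mlead f)).
case: (ex_minnP exQ) => d /asboolP[m md mp] dmin.
have ds : (d < s)%N := leq_ltn_trans (dmin _ Qlead) lt.
have /negP[] : u * (taylor f)@_m \notin p by rewrite notin_primeM.
have := uf m; rewrite md ds => /(_ isT); rewrite taylorM mcoeffM.
have lt0 : (mdeg (0%MM : 'X_{1..N}) < (mdeg m).+1)%N by rewrite mdeg0.
rewrite (bigD1 (BMultinom lt0, BMultinom (ltnSn (mdeg m)))) /=; last first.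
  by rewrite add0m.
rewrite mcoeff0_taylor; set S := \sum_(i | _) _ => h.
suff Sp : S \in p by have := rpredB h Sp; rewrite addrK.
apply: rpred_sum => -[a b] /= /andP[/eqP mE ne]; apply: idealMr.
apply: contraT => bp.
have : (d <= mdeg b)%N by apply: dmin; apply/asboolP; exists b.
have : mdeg m = (mdeg a + mdeg b)%N by rewrite [in LHS]mE mdegD.
move=> e le; have : mdeg a == 0%N by lia.
rewrite mdeg_eq0 => /eqP a0; move: ne.
suff -> : (a, b) = (BMultinom lt0, BMultinom (ltnSn (mdeg m))) by rewrite eqxx.
have ab : bmnm b = m by rewrite [RHS]mE a0 add0m.
by congr pair; apply/val_inj.
Qed.

End Vanishing.

(** * Nakayama's lemma at a prime ideal *)

Section Nakayama.
Variables (A : comNzRingType) (p : prime_idealr A).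

Definition prime_square : A -> Prop :=
  ideal_gen (fun c => exists a b, [/\ a \in p, b \in p & c = a * b]).

Lemma prod_notin_prime I (r : seq I) (F : I -> A) :
  (forall i, F i \notin p) -> \prod_(i <- r) F i \notin p.
Proof.
move=> h; elim/big_ind: _ => //; first exact: notin_prime1.
by move=> a b; exact: notin_primeM.
Qed.

Lemma exp_notin_prime u n : u \notin p -> u ^+ n \notin p.
Proof.
move=> up; elim: n => [|n IH]; first by rewrite expr0 notin_prime1.
by rewrite exprS notin_primeM.
Qed.

(** Modulo p the matrix is diagonal. In the Leibniz formula, every permutation
    other than the identity meets an off-diagonal entry. *)
Lemma det_diag_notin_prime q (W : 'M[A]_q) :
  (forall i, W i i \notin p) -> (forall i j, i != j -> W i j \in p) ->
  \det W \notin p.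
Proof.
move=> diag off; rewrite /determinant (bigD1 (1%g : {perm _})) //=.
rewrite odd_perm1 expr0 mul1r; set P := \prod_i _; set R := \sum_(i | _) _.
have Pp : P \notin p by apply: prod_notin_prime => i; rewrite perm1.
suff Rp : R \in p.
  by apply/negP=> h; have := rpredB h Rp; rewrite addrK (negPf Pp).
apply: rpred_sum => s s1; apply: idealMr.
have [i si] : exists i, s i != i.
  apply/existsP; apply: contraT => /existsPn h; case/eqP: s1; apply/permP=> i.
  by rewrite perm1; apply/eqP; rewrite -[_ == _]negbK h.
rewrite (bigD1 i) //= mulrC; apply: idealMr; apply: off.
by rewrite eq_sym.
Qed.

(** The determinant trick. The relations u_j F_j = sum_i T_ji t_i +
    sum_m B_jm F_m, with all B_jm in p, say that the matrix diag(u) - B sends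
    the vector F to T t; multiplying by its adjugate replaces it by its
    determinant, which is outside p. *)
Lemma nakayama q e (F : 'I_q -> A) (t : 'I_e -> A) :
  (forall h, h \in p -> exists b : 'I_q -> A, h = \sum_j b j * F j) ->
  (forall j, F j \in p) ->
  (forall h, h \in p -> exists2 u, u \notin p
     & exists a : 'I_e -> A, prime_square (u * h - \sum_i a i * t i)) ->
  exists2 d, d \notin p &
    exists H : 'I_q -> 'I_e -> A, forall j, d * F j = \sum_i H j i * t i.
Proof.
move=> genF Fp gen.
have sqE z : prime_square z -> exists2 b : 'I_q -> A,
    (forall j, b j \in p) & z = \sum_j b j * F j.
  case=> s; elim: s z => [|w s IH] z sG ->.
    exists (fun=> 0) => [j|]; first exact: rpred0.
    by rewrite big_nil big1 // => j _; rewrite mul0r.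
  have [y ys|b bp bE] := IH _ _ erefl; first by apply: sG; rewrite inE ys orbT.
  have [|a [c [ap /genF[b' cE] wE]]] := sG w; first by rewrite mem_head.
  exists (fun j => w.1 * (b' j * a) + b j) => [j|].
    by apply: rpredD => //; do 2!apply: idealMr.
  rewrite big_cons bE wE cE !mulr_sumr -big_split.
  by apply: eq_bigr => j _ /=; ring.
have /choice[u uP] : forall j, exists u, u \notin p /\
    exists a : 'I_e -> A, prime_square (u * F j - \sum_i a i * t i).
  by move=> j; have [u up aP] := gen _ (Fp j); exists u.
have /choice[T TP] : forall j, exists a : 'I_e -> A,
    prime_square (u j * F j - \sum_i a i * t i) by move=> j; have [] := uP j.
have /choice[B BP] : forall j, exists b : 'I_q -> A, (forall i, b i \in p) /\
    u j * F j - \sum_i T j i * t i = \sum_i b i * F i.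
  by move=> j; have [b bp bE] := sqE _ (TP j); exists b.
pose W := \matrix_(i, j) ((if i == j then u i else 0) - B i j) : 'M[A]_q.
exists (\det W).
  apply: det_diag_notin_prime => [i|i j /negPf ij]; rewrite mxE.
    rewrite eqxx; apply/negP=> h; have [+ _] := uP i; case/negP.
    by have := rpredD h ((BP i).1 i); rewrite subrK.
  by rewrite ij sub0r; apply: rpredNr; exact: (BP i).1.
exists (fun j i => \sum_m \adj W j m * T m i) => j.
have WF m : \sum_i W m i * F i = \sum_i T m i * t i.
  have [_ e1] := BP m; rewrite -[RHS](subKr (u m * F m)) e1 -sumrN.
  under eq_bigr do rewrite mxE mulrBl.
  rewrite big_split /= (bigD1 m) //= eqxx big1 ?addr0 ?sumrN //.
  by move=> i /negPf; rewrite eq_sym => ->; rewrite mul0r.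
transitivity (\sum_i (\adj W *m W) j i * F i).
  rewrite mul_adj_mx (bigD1 j) //= mxE eqxx mulr1n big1 ?addr0 // => i ij.
  by rewrite mxE eq_sym (negPf ij) mulr0n mul0r.
under eq_bigr do rewrite mxE mulr_suml.
rewrite exchange_big /=.
under eq_bigr do under eq_bigr do rewrite -mulrA.
under eq_bigr do rewrite -mulr_sumr WF mulr_sumr.
rewrite exchange_big /=; apply: eq_bigr => i _; rewrite mulr_suml.
by apply: eq_bigr => m _; rewrite mulrA.
Qed.

End Nakayama.

(** * Expansions in powers of cotangent generators *)

Section Expansion.
Variables (k : fieldType) (N : nat).
Local Notation A := {mpoly k[N]}.
Variables (p : prime_idealr A) (e : nat) (t : 'I_e -> A) (u : A).

Lemma card_bmultinom n b : (#|{: 'X_{1..n < b}}| <= b ^ n)%N.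
Proof.
have lt (m : 'X_{1..n < b}) (i : 'I_n) : (m i < b)%N.
  by apply: leq_ltn_trans (bmdeg m); rewrite mdegE (bigD1 i) //= leq_addr.
pose f (m : 'X_{1..n < b}) := [ffun i : 'I_n => Ordinal (lt m i)].
have f_inj : injective f.
  move=> m m' /ffunP h; apply/val_inj/mnmP => i.
  by have := h i; rewrite !ffunE => /(congr1 val).
by have := leq_card f f_inj; rewrite card_ffun !card_ord.
Qed.

(** The element x is a combination of the t^m (written mmap1 t m) with |m| < s
    and standard coefficients, up to an error vanishing to order s. The powers
    of u are normalised so that the term of index m carries u^(s - |m|): this
    is what s steps of multiplication by u produce. *)
Definition expansion (s D : nat) (x : A) : Prop :=
  exists l : 'X_{1..e < s} -> A,
    (forall m, standard_poly p (l m) /\ (msize (l m) <= D)%N) /\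
    vanish p s
      (x - \sum_(m : 'X_{1..e < s}) u ^+ (s - mdeg m) * mmap1 t m * l m).

Lemma expansionD s D x y :
  expansion s D x -> expansion s D y -> expansion s D (x + y).
Proof.
move=> [l [lP lV]] [l' [lP' lV']]; exists (fun m => l m + l' m); split=> [m|].
  have [[ls lD] [ls' lD']] := (lP m, lP' m); split.
    exact: standard_polyD.
  by apply: leq_trans (msizeD_le _ _) _; rewrite geq_max lD.
have := vanishD lV lV'; congr vanish.
under [in RHS]eq_bigr do rewrite mulrDr.
by rewrite big_split /= opprD addrACA.
Qed.

Lemma expansion_vanish s D x : vanish p s x -> expansion s D x.
Proof.
move=> xV; exists (fun=> 0); split=> [m|].
  by rewrite msize0; split=> //; exact: standard_poly0.
by rewrite big1 ?subr0 // => m _; rewrite mulr0.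
Qed.

Lemma expansion_sum s D (I : finType) (F : I -> A) :
  (forall i, expansion s D (F i)) -> expansion s D (\sum_i F i).
Proof.
move=> h; apply: (big_ind (expansion s D)) => [||i _]; last exact: h.
  exact/expansion_vanish/vanishx0.
by move=> x y; exact: expansionD.
Qed.

Lemma expansion_term s D (m : 'X_{1..e}) l :
  (mdeg m < s)%N -> standard_poly p l -> (msize l <= D)%N ->
  expansion s D (u ^+ (s - mdeg m) * mmap1 t m * l).
Proof.
move=> ms ls lD; pose m0 := BMultinom ms.
exists (fun m' => if m' == m0 then l else 0); split=> [m'|].
  by case: eqP => // _; rewrite msize0; split=> //; exact: standard_poly0.
rewrite (bigD1 m0) //= eqxx big1 ?addr0 ?subrr => [|m' /negPf->].
  exact: vanishx0.
by rewrite mulr0.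
Qed.

Lemma mmap1_vanish (m : 'X_{1..e}) :
  (forall i, t i \in p) -> vanish p (mdeg m) (mmap1 t m).
Proof.
move=> tp; rewrite mdegE /mmap1; elim/big_ind2: _ => //.
  by move=> a f b g; exact: vanishM.
move=> i _; elim: (m i) => [|n IH]; first by [].
by rewrite exprS -add1n; apply: vanishM => //; exact: vanish1.
Qed.

Hypothesis tp : forall i, t i \in p.
Variable c : nat.
Hypothesis division_step : forall f, exists l (a : 'I_e -> A),
  [/\ u * f = u * l + \sum_i a i * t i, standard_poly p l,
      (msize l <= msize f)%N & forall i, (msize (a i) <= msize f + c)%N].

(** Each multiplication by u makes the coefficient f standard, at the cost of
    terms with one more factor t_i and c more degrees. Once the exponent of t
    reaches the target order, the whole term is an error. *)
Lemma expand_term D j (m : 'X_{1..e}) f :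
  (msize f + c * j <= D)%N ->
  expansion (j + mdeg m) D (u ^+ j * mmap1 t m * f).
Proof.
elim: j m f => [|j IH] m f fD.
  rewrite expr0 mul1r add0n mulrC; apply: expansion_vanish.
  by apply: vanishMl; exact: mmap1_vanish.
have [l [a [fE ls lf af]]] := division_step f.
have -> : u ^+ j.+1 * mmap1 t m * f = u ^+ j.+1 * mmap1 t m * l
    + \sum_i u ^+ j * mmap1 t (m + U_(i)) * a i.
  transitivity (u ^+ j * mmap1 t m * (u * f)); first by rewrite exprS; ring.
  rewrite fE mulrDr mulr_sumr; congr (_ + _); first by rewrite exprS; ring.
  apply: eq_bigr => i _; rewrite commr_mmap1_M ?mmap1U; first by ring.
  by move=> *; exact: mulrC.
apply: expansionD.
  rewrite -[X in u ^+ X](addnK (mdeg m)); apply: expansion_term => //.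
    by rewrite addSn ltnS leq_addl.
  by apply: leq_trans lf _; lia.
apply: expansion_sum => i.
have -> : (j.+1 + mdeg m)%N = (j + mdeg (m + U_(i)))%N.
  by rewrite mdegD mdeg1; lia.
by apply: IH; have := af i; lia.
Qed.

Lemma expand s D f : (msize f + c * s <= D)%N -> expansion s D (u ^+ s * f).
Proof.
move=> /(expand_term 0%MM); rewrite mdeg0 addn0 /mmap1 big1 ?mulr1 //.
by move=> i _; rewrite mnm0E expr0.
Qed.

(** If there were fewer pairs (t-exponent, standard monomial) than monomials
    with exponents below S, a nontrivial combination f of the latter would
    have a zero expansion. Then u^s f would vanish to order s, which exceeds
    the degree of f. *)
Lemma box_le_standard S s : u \notin p -> s = (N * S).+1 ->
  (S ^ N <= s ^ e * #|standard_monomial p (s + c * s)|)%N.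
Proof.
move=> up sE.
pose X (g : {ffun 'I_N -> 'I_S}) : 'X_{1..N} := [multinom val (g i) | i < N].
have X_inj : injective X.
  move=> g g' /mnmP h; apply/ffunP=> i; apply/val_inj.
  by have := h i; rewrite !mnmE.
have degX g : (mdeg (X g) <= N * S)%N.
  rewrite mdegE -[X in (_ <= X * _)%N]card_ord -sum_nat_const.
  apply: leq_sum => i _.
  by rewrite mnmE; exact/ltnW/ltn_ord.
have /choice[l lP] : forall g, exists l : 'X_{1..e < s} -> A,
    (forall m, standard_poly p (l m) /\ (msize (l m) <= s + c * s)%N) /\
    vanish p s (u ^+ s * 'X_[X g] -
      \sum_(m : 'X_{1..e < s}) u ^+ (s - mdeg m) * mmap1 t m * l m).
  by move=> g; apply: expand; rewrite msizeX leq_add2r sE ltnS degX.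
rewrite leqNgt; apply/negP=> lt.
have [|d [g0 dg0] dP] := @exists_relation k {ffun 'I_N -> 'I_S}
    ('X_{1..e < s} * standard_monomial p (s + c * s))%type
    (fun g y => (l g y.1)@_(val y.2)).
  rewrite card_prod card_ffun !card_ord; apply: leq_ltn_trans lt.
  by rewrite leq_mul2r card_bmultinom orbT.
pose f : A := \sum_g d g *: 'X_[X g].
have cf m : f@_m = \sum_g d g * (X g == m)%:R.
  rewrite /f raddf_sum /=; apply: eq_bigr => g _.
  by rewrite mcoeffZ mcoeffX.
have f0 : f != 0.
  apply: contraNneq dg0 => f0; rewrite -(mcoeff0 k (X g0)) -f0 cf.
  rewrite (bigD1 g0) //= eqxx mulr1 big1 ?addr0 // => g gg0.
  by rewrite (inj_eq X_inj) (negPf gg0) mulr0.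
have ldeg : (mdeg (mlead f) <= N * S)%N.
  have : f@_(mlead f) != 0 by rewrite mleadc_eq0.
  rewrite cf; have [g /eqP <- _|h] := pickP (fun g => X g == mlead f).
    exact: degX.
  by rewrite big1 ?eqxx // => g _; rewrite h mulr0.
suff uf : vanish p s (u ^+ s * f).
  by have := vanish_bound (exp_notin_prime s up) f0 uf; rewrite sE ltnNge ldeg.
have lE m : \sum_g d g *: l g m = 0.
  apply/mpolyP=> m'; rewrite mcoeff0 raddf_sum /=.
  under eq_bigr do rewrite mcoeffZ.
  have [/andP[lt' st]|nst] :=
      boolP ((mdeg m' < s + c * s)%N && `[< standard p m' >]).
    have st' : `[< standard p (BMultinom lt') >] by [].
    exact: (dP (m, exist _ (BMultinom lt') st')).
  rewrite big1 // => g _; apply/eqP.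
  rewrite mulf_eq0 mcoeff_eq0; apply/orP; right.
  apply: contra nst => m'l; have [[ls lD] _] := ((lP g).1 m, 0%N).
  apply/andP; split; first exact: leq_trans (msize_mdeg_lt m'l) lD.
  by apply/asboolP; exact: ls.
have -> : u ^+ s * f = \sum_g (d g)%:MP * (u ^+ s * 'X_[X g] -
      \sum_(m : 'X_{1..e < s}) u ^+ (s - mdeg m) * mmap1 t m * l g m).
  under [RHS]eq_bigr do rewrite mulrBr.
  rewrite sumrB [X in _ - X](_ : _ = 0) ?subr0.
    by rewrite mulr_sumr; apply: eq_bigr => g _; rewrite -mul_mpolyC; ring.
  under eq_bigr do rewrite mulr_sumr.
  rewrite exchange_big big1 //= => m _.
  transitivity (u ^+ (s - mdeg m) * mmap1 t m * \sum_g d g *: l g m).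
    by rewrite mulr_sumr; apply: eq_bigr => g _; rewrite -mul_mpolyC; ring.
  by rewrite lE mulr0.
apply: (big_ind (vanish p s)) => [||g _]; first exact: vanishx0.
  by move=> *; exact: vanishD.
by apply: vanishMl; exact: (lP g).2.
Qed.

End Expansion.

(** * Chains of primes in polynomial rings *)

Section Chains.
Variables (k : fieldType) (N : nat).
Local Notation A := {mpoly k[N]}.

(** Ideals as Prop-valued predicates, so that the zero ideal and preimages of
    primes of another ring are treated uniformly. The whole ring satisfies
    these conditions. *)
Record is_prime (P : A -> Prop) : Prop := IsPrime {
  is_prime0 : P 0;
  is_primeD : forall a b, P a -> P b -> P (a + b);
  is_primeMl : forall a b, P b -> P (a * b);
  is_primeM : forall a b, P (a * b) -> P a \/ P b }.

Definition free_mod (P : A -> Prop) (I : finType) (F : I -> A) : Prop :=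
  forall c : I -> k, P (\sum_i c i *: F i) -> forall i, c i = 0.

(** In a relation modulo P0, let j be the least exponent of x with a nonzero
    coefficient. As x is not in the prime P0, the factor x^j can be removed;
    as x is in P1, what remains is, modulo P1, the part of exponent j alone,
    which is a relation for F. *)
Lemma free_mod_step (P0 P1 : A -> Prop) (I : finType) (F : I -> A) x S :
  is_prime P0 -> is_prime P1 -> (forall a, P0 a -> P1 a) -> P1 x -> ~ P0 x ->
  free_mod P1 F ->
  free_mod P0 (fun ij : I * 'I_S => x ^+ ij.2 * F ij.1).
Proof.
move=> P0p P1p P01 P1x P0x Ffree c P0c.
pose w (j : 'I_S) : A := \sum_i c (i, j) *: F i.
have wE : \sum_ij c ij *: (x ^+ ij.2 * F ij.1) =
    \sum_(j < S) x ^+ j * w j.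
  transitivity (\sum_ij c (ij.1, ij.2) *: (x ^+ ij.2 * F ij.1)).
    by apply: eq_bigr; case.
  rewrite -(pair_bigA _ (fun i (j : 'I_S) => c (i, j) *: (x ^+ j * F i))).
  rewrite exchange_big /=.
  apply: eq_bigr => j _; rewrite mulr_sumr; apply: eq_bigr => i _.
  by rewrite scalerAr.
rewrite wE in P0c.
have expn n : ~ P0 (x ^+ n).
  elim: n => [|n IH]; last by rewrite exprS => /(is_primeM P0p)[].
  by move=> h; apply: P0x; rewrite -[x]mulr1; exact: is_primeMl.
(* Induction on the exponent j0: the coefficients of smaller exponents
   vanish. *)
suff c0 j0 : forall i j, val j = j0 -> c (i, j) = 0.
  by move=> [i j]; exact: (c0 j).
elim/ltn_ind: j0 => j0 IH i j /= jj0.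
move: i; apply: (Ffree (fun i => c (i, j))).
have wlt (j' : 'I_S) : (j' < j)%N -> w j' = 0.
  move=> lt; rewrite /w big1 // => i _.
  by rewrite (IH j') ?scale0r // -jj0.
pose R : A := \sum_(j' : 'I_S | (j < j')%N) x ^+ (j' - j.+1) * w j'.
have sE : \sum_j' x ^+ (val j') * w j' = x ^+ j * (w j + x * R).
  rewrite (bigID (fun j' : 'I_S => (j' < j)%N)) /= big1 ?add0r => [|j' lt].
    rewrite (bigD1 j) ?ltnn //= mulrDr; congr (_ + _); rewrite !mulr_sumr.
    apply: eq_big => [j'|j' /andP[le ne]].
      by rewrite -leqNgt ltn_neqAle andbC eq_sym.
    rewrite !mulrA -exprSr -exprD subnKC // ltn_neqAle leqNgt le andbT.
    by rewrite eq_sym.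
  by rewrite wlt // mulr0.
have [/expn//|P0w] : P0 (x ^+ j) \/ P0 (w j + x * R).
  by apply: is_primeM => //; rewrite -sE.
have -> : \sum_i c (i, j) *: F i = (w j + x * R) + (- R) * x.
  by rewrite mulNr [R * x]mulrC addrK.
by apply: (is_primeD P1p (P01 _ P0w)); exact: is_primeMl.
Qed.

Lemma msizeM_leD (f g : A) : (msize (f * g) <= msize f + msize g)%N.
Proof.
have [->|f0] := eqVneq f 0; first by rewrite mul0r msize0.
have [->|g0] := eqVneq g 0; first by rewrite mulr0 msize0.
rewrite msizeM_proper ?leq_pred // mulf_neq0 ?mleadc_eq0 //.
Qed.

Lemma msizeXM_le (x f : A) n : (msize (x ^+ n * f) <= n * msize x + msize f)%N.
Proof.
elim: n => [|n IH]; first by rewrite expr0 mul1r.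
rewrite exprS -mulrA (leq_trans (msizeM_leD _ _)) // mulSn -addnA.
by rewrite leq_add2l.
Qed.

Lemma free_card (P : A -> Prop) (I : finType) (F : I -> A) B :
  P 0 -> free_mod P F -> (forall i, (msize (F i) <= B)%N) -> (#|I| <= B ^ N)%N.
Proof.
move=> P0 Ffree FB; apply: leq_trans (card_bmultinom N B).
rewrite leqNgt; apply/negP=> lt.
have [c [i ci] cP] :=
  exists_relation (fun i (m : 'X_{1..N < B}) => (F i)@_m) lt.
suff s0 : \sum_i c i *: F i = 0.
  by move: ci; rewrite (Ffree c) ?eqxx // s0.
apply/mpolyP=> m; rewrite mcoeff0 raddf_sum /=.
under eq_bigr do rewrite mcoeffZ.
have [mB|Bm] := ltnP (mdeg m) B; first exact: (cP (BMultinom mB)).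
rewrite big1 // => i' _; rewrite (@memN_msupp_eq0 _ _ (F i')) ?mulr0 //.
by apply: msize_mdeg_ge; apply: leq_trans Bm.
Qed.

Lemma free_chain (P : nat -> A -> Prop) (x : nat -> A) l X D S
    (I : finType) (F : I -> A) :
  (forall j, (j <= l)%N -> is_prime (P j)) ->
  (forall j, (j < l)%N -> [/\ forall a, P j a -> P j.+1 a,
     P j.+1 (x j), ~ P j (x j) & (msize (x j) <= X)%N]) ->
  free_mod (P l) F -> (forall i, (msize (F i) <= D)%N) ->
  exists (J : finType) (G : J -> A), [/\ #|J| = (#|I| * S ^ l)%N,
    free_mod (P 0) G & forall j, (msize (G j) <= D + l * (S * X))%N].
Proof.
elim: l I F D => [|l IH] I F D Pp Px Ff FD.
  by exists I, F; split=> //; rewrite ?expn0 ?muln1 // => j; rewrite addn0.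
have [Pl xl xnl xX] := Px l (ltnSn l).
have := free_mod_step (S := S) (Pp l (leqnSn l)) (Pp l.+1 (leqnn _))
  Pl xl xnl Ff.
move=> /(IH _ _ (D + S * X)%N)[|||].
- by move=> j jl; apply: Pp; exact: leq_trans (leqnSn l).
- by move=> j jl; apply: Px; exact: leq_trans (leqnSn l).
- move=> [i j] /=; apply: leq_trans (msizeXM_le _ _ _) _.
  by rewrite addnC leq_add // leq_mul // ltnW.
move=> J [G [cJ Gf GD]]; exists J, G; split=> //.
  by rewrite cJ card_prod card_ord expnS mulnA.
by move=> j; apply: leq_trans (GD j) _; rewrite mulSn addnA.
Qed.

Variable p : prime_idealr A.

(** The height theorem for polynomial rings: comparing the two estimates of the
    number of standard monomials of degree O(S), for large S, bounds the
    length of the chain by the number of cotangent generators. *)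
Lemma prime_chain_bound e (t : 'I_e -> A) (P : nat -> A -> Prop)
    (x : nat -> A) l :
  (forall i, t i \in p) ->
  (forall f, f \in p -> exists2 u, u \notin p
     & exists a : 'I_e -> A, prime_square p (u * f - \sum_i a i * t i)) ->
  (forall j, (j <= l)%N -> is_prime (P j)) ->
  (forall j, (j < l)%N -> [/\ forall a, P j a -> P j.+1 a,
     P j.+1 (x j) & ~ P j (x j)]) ->
  (forall a, P l a -> a \in p) -> (l <= e)%N.
Proof.
move=> tp gen Pp Px Plp.
have [q [F [Fp FP]]] := division p.
have genF h : h \in p -> exists b : 'I_q -> A, h = \sum_j b j * F j.
  move=> hp; have [r [b [hE rs _ _]]] := FP h.
  exists b; rewrite {1}hE (standard_poly_eq0 rs) ?add0r //.
  have -> : r = h - \sum_j b j * F j by rewrite {1}hE addrK.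
  by apply: rpredB => //; apply: rpred_sum => j _; exact: idealMr.
have [u up [H HE]] := nakayama genF Fp gen.
pose c := (\max_j \max_i msize (H j i))%N.
have step f : exists r (a : 'I_e -> A),
  [/\ u * f = u * r + \sum_i a i * t i, standard_poly p r,
      (msize r <= msize f)%N & forall i, (msize (a i) <= msize f + c)%N].
  have [r [b [fE rs rf bf]]] := FP f.
  exists r, (fun i => \sum_j b j * H j i); split=> //.
    rewrite {1}fE mulrDr; congr (_ + _); rewrite mulr_sumr.
    under eq_bigr do rewrite mulrCA HE mulr_sumr.
    rewrite exchange_big; apply: eq_bigr => i _; rewrite mulr_suml.
    by apply: eq_bigr => j _; rewrite mulrA.
  move=> i; apply: leq_trans (msize_sum _ _ _) _; apply/bigmax_leqP => j _.
  apply: leq_trans (msizeM_leD _ _) _; apply: leq_add; first exact: bf.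
  by apply: leq_trans (leq_bigmax j); exact: (leq_bigmax i).
pose X := (\max_(j < l) msize (x j))%N.
(* With s = N * S + 1 <= (N + 1) * S, standard monomials of degree at most
   (c + 1) * s and x_j of size at most X, the products that are shown to be
   independent have size at most (N + 1) * (c + 1) * S + l * X * S. *)
have bound S : (0 < S)%N ->
    (S ^ (N + l) <= (N.+1 ^ e * (N.+1 * c.+1 + l * X) ^ N) * S ^ (e + N))%N.
  move=> S0; pose s := (N * S).+1.
  have le1 := box_le_standard tp step up (erefl s).
  pose D := (s + c * s)%N.
  pose E (g : standard_monomial p D) : A := 'X_[val g].
  have Efree : free_mod (P l) E.
    move=> d /Plp dp g.
    have : \sum_g d g *: E g = 0.
      apply: standard_poly_eq0 dp; apply: big_ind => [||g' _].
      - exact: standard_poly0.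
      - by move=> *; exact: standard_polyD.
      apply: standard_polyZ => m; rewrite msuppX inE => /eqP->.
      by have /asboolP := valP g'.
    move/(congr1 (mcoeff (val g))); rewrite mcoeff0 raddf_sum /=.
    rewrite (bigD1 g) //= mcoeffZ mcoeffX eqxx mulr1 big1 ?addr0 // => g' gg'.
    rewrite mcoeffZ mcoeffX (inj_eq val_inj) (inj_eq val_inj).
    by rewrite (negPf gg') mulr0.
  have Esize g : (msize (E g) <= D)%N.
    by rewrite msizeX; exact: (bmdeg (val g)).
  have [|J [G [cJ Gf GD]]] := free_chain (x := x) (X := X) S Pp _ Efree Esize.
    move=> j jl; have [h1 h2 h3] := Px j jl; split=> //.
    exact: (leq_bigmax (Ordinal jl)).
  have := free_card (is_prime0 (Pp 0%N (leq0n l))) Gf GD; rewrite cJ => le2.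
  have sS : (s <= N.+1 * S)%N by rewrite /s mulSn addnC -addn1 leq_add2l.
  rewrite expnD; apply: leq_trans (leq_mul le1 (leqnn (S ^ l))) _.
  rewrite -mulnA; apply: leq_trans (leq_mul (leqnn _) le2) _.
  have mono a b n : (a <= b -> a ^ n <= b ^ n)%N.
    by case: n => // n; rewrite leq_exp2r.
  rewrite expnD mulnACA -!expnMn; apply: leq_mul; apply: mono => //.
  by rewrite /D -mulSn; move: sS; clear; nia.
rewrite leqNgt; apply/negP=> el.
pose K := (N.+1 ^ e * (N.+1 * c.+1 + l * X) ^ N)%N.
(* Since l > e, the bound fails as soon as S exceeds the constant K. *)
have := bound K.+1 isT; rewrite -/K; apply/negP; rewrite -ltnNge.
apply: (@leq_trans (K.+1 * K.+1 ^ (e + N))).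
  by rewrite ltn_pmul2r // expn_gt0.
by rewrite -expnS leq_exp2l //; lia.
Qed.

End Chains.

(** * Determinants whose submaximal minors lie in a prime ideal *)

Section Determinants.
Variable A : comNzRingType.

Lemma injective_lift n (f : 'I_n -> 'I_n.+1) : injective f ->
  exists (i : 'I_n.+1) (s : {perm 'I_n}), forall k, f k = lift i (s k).
Proof.
move=> f_inj.
have [i fi] : exists i, forall k, f k != i.
  apply: contrapT => h; have : (#|'I_n.+1| <= #|codom f|)%N.
    apply/subset_leq_card/subsetP => i _; apply: contrapT => ni.
    by apply: h; exists i => k; apply/eqP=> fk; apply: ni; rewrite -fk codom_f.
  by rewrite card_codom // !card_ord ltnn.
have /choice[h hE] : forall k, exists k', f k = lift i k'.
  move=> k; case: (unliftP i (f k)) => [k' ->|/eqP]; first by exists k'.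
  by rewrite (negPf (fi k)).
have h_inj : injective h by move=> k k' e; apply: f_inj; rewrite !hE e.
by exists i, (perm h_inj) => k; rewrite permE hE.
Qed.

Lemma det_mxsub_perm n (M : 'M[A]_n) (s s' : {perm 'I_n}) :
  \det (mxsub s s' M) = (-1) ^+ s * (-1) ^+ s' * \det M.
Proof.
have -> : mxsub s s' M = perm_mx s *m M *m (perm_mx s')^T.
  rewrite -row_permE tr_perm_mx -col_permE.
  by apply/matrixP=> i j; rewrite !mxE.
by rewrite !det_mulmx det_tr !det_perm mulrAC.
Qed.

Lemma det_mxsub_notinj m n n' (f : 'I_m -> 'I_n) (g : 'I_m -> 'I_n')
    (M : 'M[A]_(n, n')) : ~ injective f -> \det (mxsub f g M) = 0.
Proof.
move=> f_ninj; have [i [j ij fij]] : exists i, exists2 j, i != j & f i = f j.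
  apply: contrapT => h; apply: f_ninj => i j fij; apply: contrapT => /eqP ij.
  by apply: h; exists i, j.
by apply: (determinant_alternate ij) => l; rewrite !mxE fij.
Qed.

Variable p : prime_idealr A.

(** The minors with increasing index maps control all the others: a
    non-injective map repeats a row or a column, and an injective map from
    'I_n to 'I_n.+1 is a permutation followed by some lift i. *)
Lemma minors_in n (M : 'M[A]_n.+1) :
  (forall i j, \det (mxsub (lift i) (lift j) M) \in p) ->
  forall f g : 'I_n -> 'I_n.+1, \det (mxsub f g M) \in p.
Proof.
move=> h f g.
have [f_inj|/det_mxsub_notinj->] := pselect (injective f); last exact: rpred0.
have [g_inj|g_ninj] := pselect (injective g); last first.
  rewrite -det_tr trmx_mxsub det_mxsub_notinj //; exact: rpred0.
have [i [s fE]] := injective_lift f_inj.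
have [j [s' gE]] := injective_lift g_inj.
have -> : mxsub f g M = mxsub s s' (mxsub (lift i) (lift j) M).
  by apply/matrixP=> a b; rewrite !mxE fE gE.
by rewrite det_mxsub_perm; apply: idealMr.
Qed.

(** Multiply on the left by the block matrix with rows (1, 0) and (-c, a), where
    a is the pivot M 0 0 and c is the rest of its column. *)
Lemma schur_complement m (M : 'M[A]_m.+1) :
  M 0 0 ^+ m * \det M = M 0 0 * \det (\matrix_(i, j)
    (M 0 0 * M (lift 0 i) (lift 0 j) - M (lift 0 i) 0 * M 0 (lift 0 j))).
Proof.
pose M' : 'M[A]_(1 + m) := M.
have M00 : ulsubmx M' = (M 0 0)%:M.
  by rewrite [LHS]mx11_scalar !mxE !lshift0.
have : block_mx 1 0 (- dlsubmx M') (M 0 0)%:M *m M' =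
    block_mx (M 0 0)%:M (ursubmx M') 0
      (M 0 0 *: drsubmx M' - dlsubmx M' *m ursubmx M').
  rewrite -[X in _ *m X](submxK M') mulmx_block !mul1mx !mul0mx !addr0 M00.
  rewrite mul_mx_scalar !mul_scalar_mx scalerN addNr.
  by rewrite mulNmx [- _ + _]addrC.
move/(congr1 determinant); rewrite det_mulmx det_lblock det_ublock.
rewrite det1 mul1r !det_scalar expr1 => ->; congr (_ * \det _).
apply/matrixP=> i j; rewrite !mxE big_ord1 !mxE.
by rewrite !rshift1 !lshift0.
Qed.

(** If the first row has all its entries in p, the Laplace expansion along it
    is a sum of products of two elements of p. Otherwise some entry of this row
    is a pivot outside p. The hypothesis passes to the Schur complement, since
    each minor of the complement is, up to powers of the pivot, a minor of M
    one size larger. *)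
Lemma det_in_square n (M : 'M[A]_n.+1) :
  (forall i j, \det (mxsub (lift i) (lift j) M) \in p) ->
  exists2 w, w \notin p & prime_square p (w * \det M).
Proof.
elim: n M => [|n IH] M h.
  by have := h 0 0; rewrite det_mx00 idealr1.
have [h0|/existsNP[j /negP aNp]] := pselect (forall j, M 0 j \in p).
  exists 1; first exact: notin_prime1.
  rewrite mul1r (expand_det_row _ 0).
  apply: (big_ind (prime_square p)) => [||j _]; first exact: ideal_gen0.
    by move=> x y; exact: ideal_genD.
  exists [:: (1, M 0 j * cofactor M 0 j)]; last by rewrite big_seq1 mul1r.
  move=> z; rewrite inE => /eqP->; exists (M 0 j), (cofactor M 0 j).
  split=> //.
  rewrite /cofactor; apply: idealMr.
  have -> : row' 0 (col' j M) = mxsub (lift 0) (lift j) M; last exact: h.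
  by apply/matrixP=> k l; rewrite !mxE.
have {}h := minors_in h.
set a := M 0 j in aNp.
pose M' := \matrix_(k, l)
  (a * M (lift 0 k) (lift j l) - M (lift 0 k) j * M 0 (lift j l)).
have schur m (f g : 'I_m -> 'I_n.+1) :
    let F i := if unlift 0 i is Some k then lift 0 (f k) else 0 in
    let G i := if unlift 0 i is Some l then lift j (g l) else j in
    a ^+ m * \det (mxsub F G M) = a * \det (mxsub f g M').
  move=> F G.
  have F0 : F 0 = 0 by rewrite /F unlift_none.
  have G0 : G 0 = j by rewrite /G unlift_none.
  have Fl k : F (lift 0 k) = lift 0 (f k) by rewrite /F liftK.
  have Gl k : G (lift 0 k) = lift j (g k) by rewrite /G liftK.
  have := schur_complement (mxsub F G M); rewrite mxE F0 G0 => ->.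
  congr (_ * \det _); apply/matrixP=> k l.
  by rewrite !mxE F0 G0 Fl Gl.
have [|w wp wM] := IH M'.
  move=> k l; have := schur _ (lift k) (lift l); cbv zeta.
  set D := \det (mxsub _ _ M) => /(congr1 (fun x => x \in p)).
  have Dp : D \in p by exact: h.
  by rewrite [LHS]idealMr // prime_idealrM (negPf aNp) /= => <-.
have := schur _ id id; cbv zeta.
set F := fun i => _; set G := fun i => _ => sE.
have F_id : F =1 (1%g : {perm _}).
  by move=> i; rewrite perm1 /F; case: unliftP.
have G_inj : injective G.
  move=> x y; rewrite /G; case: (unliftP 0 x) => [x' ->|->];
  case: (unliftP 0 y) => [y' ->|->] //; first by move/lift_inj->.
    by move/eqP; rewrite eq_sym (negPf (neq_lift _ _)).
  by move/eqP; rewrite (negPf (neq_lift _ _)).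
exists (w * a ^+ n.+1).
  by apply: notin_primeM => //; exact: exp_notin_prime.
(* The pivot (0, j) is brought to the corner by a permutation of columns. *)
have FGE : mxsub F G M = mxsub (1%g : {perm _}) (perm G_inj) M.
  by apply/matrixP=> x y; rewrite !mxE F_id permE.
move: sE; rewrite FGE det_mxsub_perm odd_perm1 expr0 mul1r mxsub_id => sE.
have -> : w * a ^+ n.+1 * \det M = ((-1) ^+ perm G_inj * a) * (w * \det M').
  set e := (-1) ^+ _ in sE *; have ee : e * e = 1 by rewrite -expr2 sqrr_sign.
  transitivity (e * e * (w * a ^+ n.+1 * \det M)); first by rewrite ee mul1r.
  transitivity (e * w * (a * \det M')); last by ring.
  by rewrite -sE; ring.
exact: ideal_genM.
Qed.

End Determinants.

(** * Nonvanishing of a maximal minor of the monomial matrix *)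

Section GenericMinor.
Variables (k : fieldType) (r d n : nat) (c : {ffun 'I_n -> 'I_r.+1}).
Local Notation b := 'C(r + d, d).
Local Notation mon a := (nth 0%MM (monomials r d) a).

(** The exponent of the a-th monomial of degree d dehomogenised on the chart of
    the i-th point. *)
Definition chart_exponent (a : nat) (i : 'I_n) : 'X_{1..(n * r)} :=
  (\sum_(l < r.+1) (if unlift (c i) l is Some l' then U_(mxvec_index i l')
     else 0) *+ mon a l)%MM.

Lemma monomial_mxE a i :
  monomial_mx d (chart_coords k c) a i = 'X_[chart_exponent a i].
Proof.
rewrite mxE /chart_exponent -mprodXE; apply: eq_bigr => l _.
rewrite -mpolyXn mxE; case: (unlift (c i) l) => [l'|] //.
by rewrite mpolyX0.
Qed.

Lemma chart_exponentE a i i' (l' : 'I_r) :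
  chart_exponent a i (mxvec_index i' l') =
  (if i == i' then mon a (lift (c i) l') else 0)%N.
Proof.
have idx j (l : 'I_r) :
    (mxvec_index j l == mxvec_index i' l') = ((j, l) == (i', l')).
  apply/eqP/eqP => [e|[-> ->//]].
  have [h hK _] := curry_mxvec_bij n r.
  by rewrite -(hK (j, l)) //= e -(hK (i', l')).
rewrite /chart_exponent mnm_sumE (bigD1 (lift (c i) l')) //= liftK.
rewrite mulmnE mnm1E idx xpair_eqE eqxx andbT big1 ?addn0.
  by case: eqP => _; rewrite ?mul1n ?mul0n.
move=> l ll'; rewrite mulmnE; case: unliftP => [l0 lE|_]; last first.
  by rewrite mnm0E.
rewrite mnm1E idx xpair_eqE andbC; case: eqP => [l0E|//].
by rewrite lE l0E eqxx in ll'.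
Qed.

(** The exponents mu s of the terms of the Leibniz formula are distinct. Indeed
    the variables of the j-th point occur in mu s with the dehomogenised
    exponents of the monomial of index s^-1 j, and as the degree d is known
    these exponents determine that monomial. *)
Lemma generic_minor_neq0 (hn : (b <= n)%N) :
  \det (mxsub id (widen_ord hn) (monomial_mx d (chart_coords k c))) != 0.
Proof.
set g := widen_ord hn.
pose mu (s : {perm 'I_b}) := (\sum_(a < b) chart_exponent a (g (s a)))%MM.
have g_inj : injective g by move=> i j /(congr1 val) /= /val_inj.
have muE s j (l' : 'I_r) : mu s (mxvec_index (g j) l') =
    mon ((s^-1)%g j) (lift (c (g j)) l').
  rewrite mnm_sumE (bigD1 ((s^-1)%g j)) //= permKV chart_exponentE eqxx.
  rewrite big1 ?addn0 // => a aj; rewrite chart_exponentE (inj_eq g_inj).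
  case: eqP => // e; case/eqP: aj.
  by apply: (@perm_inj _ s); rewrite permKV.
have mu_inj s : mu s = mu 1%g -> s = 1%g.
  move=> e; suff sj j : (s^-1)%g j = j.
    by apply/permP=> j; rewrite perm1 -[in RHS](permK s j) sj.
  have memm (i : 'I_b) : mon i \in monomials r d.
    by rewrite mem_nth // size_monomials.
  have coordE l' : mon ((s^-1)%g j) (lift (c (g j)) l') =
      mon j (lift (c (g j)) l').
    by rewrite -muE e muE invg1 perm1.
  have degE (i : 'I_b) : (mon i (c (g j)) +
      \sum_(l < r.+1 | l != c (g j)) mon i l)%N = d.
    have := memm i.
    by rewrite mem_monomials mdegE (bigD1 (c (g j))) //= => /eqP.
  apply/val_inj/eqP; rewrite -(nth_uniq 0%MM _ _ (uniq_monomials r d)).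
  - apply/eqP/mnmP=> l; case: (unliftP (c (g j)) l) => [l' ->|->].
      exact: coordE.
    apply: (@addIn (\sum_(l < r.+1 | l != c (g j)) mon j l)%N).
    rewrite degE -[RHS](degE ((s^-1)%g j)); congr addn; apply: eq_bigr => l0.
    case: (unliftP (c (g j)) l0) => [l' -> _|->]; first by rewrite coordE.
    by rewrite eqxx.
  - by rewrite size_monomials; exact: ltn_ord.
  - by rewrite size_monomials; exact: ltn_ord.
have prodE (s : {perm 'I_b}) :
    \prod_i (mxsub id g (monomial_mx d (chart_coords k c))) i (s i) =
    'X_[mu s] :> {mpoly k[n * r]}.
  rewrite /mu -mprodXE; apply: eq_bigr => i _.
  by rewrite mxE monomial_mxE.
apply/eqP => /(congr1 (mcoeff (mu 1%g))).
rewrite mcoeff0 /determinant raddf_sum /=.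
rewrite (bigD1 (1%g : {perm _})) //= prodE odd_perm1 expr0 mul1r mcoeffX eqxx.
rewrite big1 ?addr0 => [/eqP|s s1]; first by rewrite oner_eq0.
rewrite prodE mulr_sign; case: (odd_perm s).
  rewrite mcoeffN mcoeffX; case: eqP => [/mu_inj sE|_]; last by rewrite oppr0.
  by rewrite sE eqxx in s1.
rewrite mcoeffX; case: eqP => [/mu_inj sE|//].
by rewrite sE eqxx in s1.
Qed.

End GenericMinor.

(** * Pulling back chains and cotangent generators from the local ring *)

Section LocalRingPullback.
Variables (A : comNzRingType) (G : A -> Prop) (p : prime_idealr A).
Hypothesis Gp : forall a, G a -> a \in p.
Local Notation L := (local_ring Gp).
Local Open Scope quotient_scope.

Definition to_loc (a : A) : L := \pi_L (loc_of p a).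

Lemma pi_locD (x y : loc_frac p) : \pi_L x + \pi_L y = \pi_L (loc_addf x y).
Proof. exact: pi_loc_add. Qed.

Lemma pi_locM (x y : loc_frac p) : \pi_L x * \pi_L y = \pi_L (loc_mulf x y).
Proof. exact: pi_loc_mul. Qed.

Lemma to_locD a b : to_loc (a + b) = to_loc a + to_loc b.
Proof.
by rewrite [RHS]pi_locD; apply/loc_eqP/loc_equiv_eq; rewrite /=; ring.
Qed.

Lemma to_locM a b : to_loc (a * b) = to_loc a * to_loc b.
Proof.
by rewrite [RHS]pi_locM; apply/loc_eqP/loc_equiv_eq; rewrite /=; ring.
Qed.

Lemma to_loc_eq a b : to_loc a = to_loc b ->
  exists2 u, u \notin p & ideal_gen G (u * (a - b)).
Proof.
by move/loc_eqP/asboolP=> /= [u up uI]; exists u; rewrite ?mulr1 in uI *.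
Qed.

Lemma to_loc_gen a : G a -> to_loc a = 0.
Proof.
move=> Ga; apply/loc_eqP/asboolP; exists 1; first exact: notin_prime1.
exists [:: (1, a)] => [z|]; first by rewrite inE => /eqP->.
by rewrite big_seq1 /=; ring.
Qed.

Lemma to_loc_inv s : s \notin p -> exists v : L, to_loc s * v = 1.
Proof.
move=> sp; exists (\pi_L (exist _ (1, s) sp)); rewrite pi_locM.
by apply/loc_eqP/loc_equiv_eq; rewrite /=; ring.
Qed.

Lemma loc_fraction (y : L) : exists a s,
  [/\ s \notin p, y * to_loc s = to_loc a & nonunit y -> a \in p].
Proof.
rewrite -[y]reprK; case: (repr y) => -[a s] /= sp; exists a, s; split=> //.
  by rewrite pi_locM; apply/loc_eqP/loc_equiv_eq; rewrite /=; ring.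
move=> ny; apply: contraT => ap; case: (ny (\pi_L (exist _ (s, a) ap))).
by rewrite pi_locM; apply/loc_eqP/loc_equiv_eq; rewrite /=; ring.
Qed.

Lemma to_loc_nonunit a : a \in p -> nonunit (to_loc a).
Proof.
move=> ap y ay1; have [b [s [sp yE _]]] := loc_fraction y.
have /to_loc_eq[u up /(ideal_gen_sub Gp)] : to_loc (a * b) = to_loc s.
  by rewrite to_locM -yE mulrA ay1 mul1r.
rewrite prime_idealrM (negPf up) /= => abs; case/negP: sp.
have : a * b - (a * b - s) \in p.
  by apply: rpredB => //; rewrite mulrC; exact: idealMr.
by rewrite opprB addrC subrK.
Qed.

Lemma pullback_sub (P : prime_idealr L) a : to_loc a \in P -> a \in p.
Proof.
move=> aP; apply: contraT => /to_loc_inv[v av1].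
by have := idealMr v aP; rewrite mulrC av1 idealr1.
Qed.

(** A denominator is a unit of the local ring, so the numerator of an element
    of Q outside P is again in Q and not in P. *)
Lemma pullback_strict (P Q : prime_idealr L) : ~ {subset Q <= P} ->
  exists a, to_loc a \in Q /\ to_loc a \notin P.
Proof.
move=> /existsNP[y /not_implyP[yQ /negP yP]].
have [a [s [sp yE _]]] := loc_fraction y; exists a; rewrite -yE; split.
  by rewrite mulrC; exact: idealMr.
rewrite prime_idealrM negb_or yP /=; apply/negP=> /pullback_sub.
by rewrite (negPf sp).
Qed.

(** Numerators of cotangent generators of the quotient generate p modulo p^2:
    the elements M of the local ring with a numerator in (t) + p^2 form an
    ideal containing the generators and the square of the maximal ideal. The
    equality of fractions holds only modulo the ideal generated by G, which
    is harmless because this ideal is locally contained in p^2. *)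
Lemma pullback_gens e :
  (forall g, G g -> exists2 w, w \notin p & prime_square p (w * g)) ->
  cotangent_dim L e -> exists t : 'I_e -> A, (forall i, t i \in p) /\
  forall f, f \in p -> exists2 u, u \notin p &
    exists a : 'I_e -> A, prime_square p (u * f - \sum_i a i * t i).
Proof.
move=> Gsq [tL [tLn gen _]].
have /choice[t tP] : forall i, exists a, a \in p /\
    exists2 s, s \notin p & tL i * to_loc s = to_loc a.
  move=> i; have [a [s [sp tE /(_ (tLn i)) ap]]] := loc_fraction (tL i).
  by exists a; split=> //; exists s.
exists t; split=> [i|f fp]; first by have [] := tP i.
(* The hypothesis on G extends to the ideal that it generates. *)
have Isq x : ideal_gen G x -> exists2 w, w \notin p & prime_square p (w * x).
  case=> s; elim: s x => [|z s IH] x sG ->.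
    by exists 1; rewrite ?notin_prime1 // big_nil mulr0; exact: ideal_gen0.
  have [y ys|w wp wI] := IH _ _ erefl; first by apply: sG; rewrite inE ys orbT.
  have [|v vp vI] := Gsq z.2; first by apply: sG; rewrite mem_head.
  exists (w * v); first exact: notin_primeM.
  rewrite big_cons.
  have := ideal_genD (ideal_genM (w * z.1) vI) (ideal_genM v wI).
  by congr ideal_gen; ring.
pose M (y : L) := exists2 u, u \notin p & exists h, y * to_loc u = to_loc h /\
  exists a : 'I_e -> A, prime_square p (h - \sum_i a i * t i).
have MD y z : M y -> M z -> M (y + z).
  move=> [u up [h [yE [a aP]]]] [v vp [g [zE [b bP]]]].
  exists (u * v); first exact: notin_primeM.
  exists (v * h + u * g); split.
    by rewrite to_locD !to_locM -yE -zE; ring.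
  exists (fun i => v * a i + u * b i).
  have := ideal_genD (ideal_genM v aP) (ideal_genM u bP); congr ideal_gen.
  under [in RHS]eq_bigr do rewrite mulrDl -!mulrA.
  by rewrite big_split /= -!mulr_sumr; ring.
have MM y z : M z -> M (y * z).
  move=> [u up [h [zE [a aP]]]]; have [b [s [sp yE _]]] := loc_fraction y.
  exists (s * u); first exact: notin_primeM.
  exists (b * h); split; first by rewrite !to_locM -yE -zE; ring.
  exists (fun i => b * a i); have := ideal_genM b aP; congr ideal_gen.
  by rewrite mulrBr mulr_sumr; under [in RHS]eq_bigr do rewrite -mulrA.
have M0 : M 0.
  exists 1; first exact: notin_prime1.
  exists 0; split; first by rewrite mul0r.
  exists (fun=> 0); rewrite big1 ?subr0 => [|i _]; last by rewrite mul0r.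
  exact: ideal_gen0.
have Mt i : M (tL i).
  have [_ [s sp tE]] := tP i; exists s => //; exists (t i); split=> //.
  exists (fun j => if j == i then 1 else 0).
  rewrite (bigD1 i) //= eqxx mul1r big1 ?addr0 ?subrr => [|j /negPf->].
    exact: ideal_gen0.
  by rewrite mul0r.
have Msq y : nonunit2 y -> M y.
  move=> [s sG ->]; rewrite big_seq.
  apply: big_ind => [//|x z|z /sG[a [b [an bn ->]]]]; first exact: MD.
  apply: MM; have [a' [u [up aE /(_ an) ap]]] := loc_fraction a.
  have [b' [v [vp bE /(_ bn) bp]]] := loc_fraction b.
  exists (u * v); first exact: notin_primeM.
  exists (a' * b'); split; first by rewrite !to_locM -aE -bE; ring.
  exists (fun=> 0); rewrite big1 ?subr0 => [|i _]; last by rewrite mul0r.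
  exists [:: (1, a' * b')]; last by rewrite big_seq1 mul1r.
  by move=> w; rewrite inE => /eqP->; exists a', b'.
have [c cP] := gen _ (to_loc_nonunit fp).
have [u up [h [fE [a aP]]]] : M (to_loc f).
  rewrite -[to_loc f](subrK (\sum_i c i * tL i)).
  apply: (MD); first exact: Msq.
  apply: big_ind => [//|x z|i _]; first exact: MD.
  exact/MM/Mt.
have [|v vp /Isq[w wp wP]] := @to_loc_eq (f * u) h; first by rewrite to_locM.
exists (w * v * u); first by rewrite !notin_primeM.
exists (fun i => w * v * a i).
have := ideal_genD wP (ideal_genM (w * v) aP); congr ideal_gen.
have -> : \sum_i w * v * a i * t i = w * v * \sum_i a i * t i.
  by rewrite mulr_sumr; apply: eq_bigr => i _; rewrite mulrA.
by ring.
Qed.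

End LocalRingPullback.

Lemma minor_in_square (A : comNzRingType) (p : prime_idealr A) (b n s : nat)
    (M : 'M[A]_(b, n)) a :
  (forall a', is_minor M s a' -> a' \in p) -> is_minor M s.+1 a ->
  exists2 w, w \notin p & prime_square p (w * a).
Proof.
move=> h [f [g [fh gh ->]]]; apply: det_in_square => i j; apply: h.
have lift_homo (i0 : 'I_s.+1) : {homo lift i0 : x y / (x < y)%N}.
  by move=> x y; rewrite /= /bump; lia.
exists (f \o lift i), (g \o lift j); split.
- by move=> x y /(lift_homo i)/fh.
- by move=> x y /(lift_homo j)/gh.
by congr determinant; apply/matrixP=> x y; rewrite !mxE.
Qed.

Lemma prime_square_sub (A : comNzRingType) (p : prime_idealr A) a :
  prime_square p a -> a \in p.
Proof.
by apply: ideal_gen_sub => _ [x [y [xp yp ->]]]; exact: idealMr.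
Qed.

(** A regular quotient of A_p by elements of p^2 is A_p itself: the cotangent
    space does not change, while a nonzero g in G would make the dimension
    drop, as the zero ideal is then strictly below every prime containing
    G. *)
Lemma regular_gens_eq0 (k : fieldType) (N : nat)
    (p : prime_idealr {mpoly k[N]}) (G : {mpoly k[N]} -> Prop)
    (Gp : forall a, G a -> a \in p) :
  (forall g, G g -> exists2 w, w \notin p & prime_square p (w * g)) ->
  regular (local_ring Gp) -> forall g, G g -> g = 0.
Proof.
move=> Gsq [e [[P Pstrict] _] /(pullback_gens Gsq)[t [tp tgen]]] g Gg.
apply: contrapT => g0.
(* The zero ideal, followed by the preimages of the primes of the chain. *)
pose Q j (a : {mpoly k[N]}) : Prop :=
  if j is j'.+1 then to_loc Gp a \in P (inord j') else a = 0.
have Qprime j : (j <= e.+1)%N -> is_prime (Q j).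
  case: j => [|j] _; split=> /=.
  - by [].
  - by move=> a b -> ->; rewrite addr0.
  - by move=> a b ->; rewrite mulr0.
  - by move=> a b /eqP; rewrite mulf_eq0 => /orP[/eqP|/eqP]; [left|right].
  - exact: rpred0.
  - by move=> a b aP bP; rewrite to_locD; exact: rpredD.
  - by move=> a b bP; rewrite to_locM; exact: idealMr.
  - by move=> a b; rewrite to_locM prime_idealrM => /orP.
have /choice[x xP] : forall j, exists x, (j < e.+1)%N ->
    [/\ forall a, Q j a -> Q j.+1 a, Q j.+1 x & ~ Q j x].
  move=> [|j].
    exists g => _; split=> //= [a ->|]; last first.
      by rewrite to_loc_gen //; exact: rpred0.
    by have /= := is_prime0 (Qprime 1%N isT).
  have [je|ej] := ltnP j.+1 e.+1; last by exists 0.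
  have [|PP /pullback_strict[a [aQ aP]]] := Pstrict (inord j) (inord j.+1).
    by rewrite !inordK // ltnW.
  by exists a => _; split=> [a' /PP||] //=; exact/negP.
have := prime_chain_bound (l := e.+1) tp tgen Qprime xP.
by rewrite ltnn => /(_ (fun a => @pullback_sub _ _ _ _ _ a)).
Qed.

Theorem theorem4p5 (k : fieldType) (r d n : nat)
    (hr : (2 <= r)%N) (hd : (2 <= d)%N) (hn : ('C(r + d, d) <= n)%N)
    (x : point k r n) :
  in_X d 2 x -> singular_point d 1 x.
Proof.
move=> hx2; set p := point_ideal x.
have b2 : (2 <= 'C(r + d, d))%N.
  case: r d hr hd {hn x p hx2} => [|r'] [|d'] // _ _.
  rewrite addSn binS addnS; have := bin_gt0 (r' + d').+1 d'.
  by have := bin_gt0 (r' + d').+1 d'.+1; lia.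
have sE : ('C(r + d, d) - 1 + 1 = ('C(r + d, d) - 2 + 1).+1)%N by lia.
have Gsq a : X_gens d 1 (chart x) a ->
    exists2 w, w \notin p & prime_square p (w * a).
  by rewrite /X_gens sE; exact: minor_in_square.
have hx1 : in_X d 1 x.
  move=> a /Gsq[w wp /prime_square_sub]; rewrite prime_idealrM.
  by rewrite (negPf wp).
exists hx1 => /(regular_gens_eq0 Gsq) gens0.
have /eqP[] := @generic_minor_neq0 k r d n (chart x) hn.
apply: gens0; rewrite /X_gens subnK; last exact: ltnW.
by exists id, (widen_ord hn); split=> // i j.
Qed.
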